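(* For every integer $m\ge 1$, $$\sum_{n=1}^{\infty}\frac{\zeta(2n)}{n16^n}\binom{2n}{m}=\begin{cases}\dfrac{1}{m}\left(1-\zeta_{E}(m-1)\left(1-\dfrac{1}{2^{m-1}}\right)\right) & \text{if } m \text{ is odd},\\[2mm] \dfrac{1}{m}\left(\zeta(m)\left(1-\dfrac{1}{2^m}\right)-1\right) & \text{if } m \text{ is even},\end{cases}$$ where $\zeta_{E}(2k)=\dfrac{(-1)^{k+1}E_{2k}\pi^{2k+1}}{4(1-4^k)(2k)!}$ for integers $k\ge 1$, the $E_{2k}$ are the Euler numbers, and for $m=1$ the product $\zeta_E(0)\left(1-\frac{1}{2^{0}}\right)$ is interpreted as $\frac{\pi}{4}$.
   Context: $\zeta(s)=\sum_{n=1}^\infty n^{-s}$ (for $\operatorname{Re}(s)>1$) is the Riemann zeta function. The Euler numbers $E_n$ are defined by $\frac{2}{e^{t}+e^{-t}}=\sum_{n=0}^{\infty}\frac{E_{n}}{n!}t^n$ (so $E_0=1$, $E_2=-1$). Binomial coefficients satisfy $\binom{2n}{m}=0$ when $m>2n$. Convention for $m=1$: cancelling the factor $1-4^k$ gives, for $k\ge1$, $\zeta_E(2k)\left(1-\frac{1}{4^k}\right)=\frac{(-1)^kE_{2k}\pi^{2k+1}}{4^{k+1}(2k)!}$, and at $k=0$ the product is taken to be the value $\frac{\pi}{4}$ of the right-hand side. *)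

(* Defs.v *)
From Stdlib Require Import Reals Lra Lia ClassicalEpsilon.
From Coquelicot Require Import Coquelicot.

Open Scope R_scope.

(* Meaningful for s > 1 only: elsewhere the series diverges and [Series]
   returns a junk value. *)
Definition zeta (s : R) : R :=
  Series (fun n : nat => Rpower (INR (S n)) (- s)).

(* [Binomial.C n m] is a quotient of factorials with truncated subtraction,
   hence nonzero for m > n; the guard restores the usual convention. *)
Definition binom (n m : nat) : R :=
  if (m <=? n)%nat then Binomial.C n m else 0.

(* 2 / (e^t + e^-t) = sum_n E_n / n! t^n near 0 *)
Definition is_euler_seq (E : nat -> R) : Prop :=
  locally 0 (fun t : R =>
    is_series (fun n : nat => E n / INR (Factorial.fact n) * t ^ n)
      (2 / (exp t + exp (- t)))).

Definition cosh_coef (n : nat) : R := (1 + (-1) ^ n) / 2 / INR (Factorial.fact n).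

(* [sech_pre n k] is the k-th Taylor coefficient of 1 / cosh for k <= n. *)
Fixpoint sech_pre (n : nat) : nat -> R :=
  match n with
  | O => fun _ => 1
  | S n' => fun k =>
      if (k <=? n')%nat then sech_pre n' k
      else - sum_f_R0 (fun i => sech_pre n' i * cosh_coef (S n' - i)) n'
  end.

Definition sech_coef (n : nat) : R := sech_pre n n.

Lemma sech_preE n k : (k <= n)%nat -> sech_pre n k = sech_coef k.
Proof.
induction n as [|n IH]; intros H.
- now replace k with 0%nat by lia.
- destruct (Nat.eq_dec k (S n)) as [->|ne]; [reflexivity|].
  simpl. destruct (Nat.leb_spec k n); [now apply IH | lia].
Qed.

Lemma sech_coefS n :
  sech_coef (S n) = - sum_f_R0 (fun i => sech_coef i * cosh_coef (S n - i)) n.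
Proof.
unfold sech_coef at 1. cbn [sech_pre].
destruct (Nat.leb_spec (S n) n); [lia|].
f_equal. apply sum_eq. intros i Hi. now rewrite sech_preE.
Qed.

Lemma cosh_coef_le1 n : Rabs (cosh_coef n) <= 1.
Proof.
unfold cosh_coef.
assert (Hf : 1 <= INR (Factorial.fact n)).
{ change 1 with (INR 1). apply le_INR. generalize (Factorial.lt_O_fact n). lia. }
assert (Hp : Rabs ((1 + (-1) ^ n) / 2) <= 1).
{ assert (H := pow_1_abs n). assert (Hu : -1 <= (-1) ^ n <= 1).
  { apply Rabs_le_between. rewrite H. lra. }
  apply Rabs_le. lra. }
unfold Rdiv at 1. rewrite Rabs_mult, Rabs_inv, (Rabs_pos_eq (INR _)) by lra.
apply Rle_trans with (1 * / 1).
- apply Rmult_le_compat; try apply Rabs_pos; auto.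
  + left. apply Rinv_0_lt_compat. lra.
  + apply Rinv_le_contravar; lra.
- lra.
Qed.

Lemma sum_pow2 n : sum_f_R0 (fun i => 2 ^ i) n = 2 ^ S n - 1.
Proof.
induction n as [|n IH]; [simpl; ring|].
rewrite tech5, IH. simpl. ring.
Qed.

Lemma sech_coef_bound n : Rabs (sech_coef n) <= 2 ^ n.
Proof.
induction n as [n IH] using (well_founded_induction PeanoNat.Nat.lt_wf_0).
destruct n as [|n].
- unfold sech_coef. simpl. rewrite Rabs_R1. lra.
- rewrite sech_coefS, Rabs_Ropp.
  eapply Rle_trans; [apply sum_f_R0_triangle|].
  apply Rle_trans with (sum_f_R0 (fun i => 2 ^ i) n).
  + apply sum_Rle. intros i Hi. rewrite Rabs_mult.
    rewrite <- (Rmult_1_r (2 ^ i)).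
    apply Rmult_le_compat; try apply Rabs_pos.
    * apply IH. lia.
    * apply cosh_coef_le1.
  + rewrite sum_pow2. lra.
Qed.

Lemma sech_radius : Rbar_le (1 / 2) (CV_radius sech_coef).
Proof.
apply (proj1 (CV_radius_bounded sech_coef)). exists 1. intros n.
rewrite Rabs_mult, <- RPow_abs, (Rabs_pos_eq (1 / 2)) by lra.
apply Rle_trans with (2 ^ n * (1 / 2) ^ n).
- apply Rmult_le_compat_r; [apply pow_le; lra | apply sech_coef_bound].
- rewrite <- Rpow_mult_distr. replace (2 * (1 / 2)) with 1 by field.
  rewrite pow1. lra.
Qed.

Lemma cosh_radius : Rbar_le 1 (CV_radius cosh_coef).
Proof.
apply (proj1 (CV_radius_bounded cosh_coef)). exists 1. intros n.
rewrite pow1, Rmult_1_r. apply cosh_coef_le1.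
Qed.

Lemma sech_cosh_mult n :
  PS_mult sech_coef cosh_coef n = if (n =? 0)%nat then 1 else 0.
Proof.
unfold PS_mult. destruct n as [|n].
- unfold sech_coef, cosh_coef. simpl. field.
- rewrite tech5, sech_coefS, Nat.sub_diag.
  replace (cosh_coef 0) with 1 by (unfold cosh_coef; simpl; field).
  simpl. ring.
Qed.

Lemma is_pseries_cosh t : is_pseries cosh_coef t ((exp t + exp (- t)) / 2).
Proof.
apply is_pseries_R.
assert (H1 := proj1 (is_pseries_R _ _ _) (is_exp_Reals t)).
assert (H2 := proj1 (is_pseries_R _ _ _) (is_exp_Reals (- t))).
assert (H := is_series_scal_l (/ 2) _ _ (is_series_plus _ _ _ _ H1 H2)).
replace ((exp t + exp (- t)) / 2)
  with (scal (/ 2) (plus (exp t) (exp (- t)))) by (cbn; field).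
revert H. apply is_series_ext. intros n. cbn.
replace (- t) with (-1 * t) by ring. rewrite Rpow_mult_distr.
unfold cosh_coef, Rdiv. ring.
Qed.

Lemma is_euler_seq_exists : exists E : nat -> R, is_euler_seq E.
Proof.
exists (fun n => sech_coef n * INR (Factorial.fact n)).
assert (h : 0 < / 2) by lra.
exists (mkposreal _ h). intros t Ht.
assert (Ht' : Rabs t < / 2).
{ revert Ht. unfold ball. cbn. unfold AbsRing_ball, abs, minus, plus, opp. cbn.
  now rewrite Ropp_0, Rplus_0_r. }
assert (Ha : Rbar_lt (Rabs t) (CV_radius sech_coef)).
{ eapply Rbar_lt_le_trans; [|apply sech_radius]. simpl. lra. }
assert (Hc : Rbar_lt (Rabs t) (CV_radius cosh_coef)).
{ eapply Rbar_lt_le_trans; [|apply cosh_radius]. simpl. lra. }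
assert (Hs := PSeries_correct _ _ (CV_radius_inside _ _ Ha)).
assert (Hm := is_pseries_mult _ _ _ _ _ Hs (is_pseries_cosh t) Ha Hc).
assert (H1 : PSeries (PS_mult sech_coef cosh_coef) t = 1).
{ rewrite PSeries_decr_1.
  - rewrite sech_cosh_mult. cbn [Nat.eqb].
    rewrite (PSeries_ext _ (fun _ => 0)).
    + rewrite PSeries_const_0. ring.
    + intros n. unfold PS_decr_1. now rewrite sech_cosh_mult.
  - eexists. exact Hm. }
rewrite (is_pseries_unique _ _ _ Hm) in H1.
assert (Hpos : 0 < exp t + exp (- t)).
{ generalize (exp_pos t) (exp_pos (- t)). lra. }
replace (2 / (exp t + exp (- t))) with (PSeries sech_coef t).
- apply is_pseries_R in Hs. revert Hs. apply is_series_ext. intros n.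
  cbn. field. apply INR_fact_neq_0.
- apply Rmult_eq_reg_r with ((exp t + exp (- t)) / 2); [|lra].
  rewrite H1. field. lra.
Qed.

Definition euler : nat -> R :=
  proj1_sig (constructive_indefinite_description _ is_euler_seq_exists).

Lemma euler_spec : is_euler_seq euler.
Proof. exact (proj2_sig (constructive_indefinite_description _ is_euler_seq_exists)). Qed.

Lemma is_euler_seq_radius E : is_euler_seq E ->
  Rbar_lt 0 (CV_radius (fun n => E n / INR (Factorial.fact n))).
Proof.
intros [d Hd].
assert (Hd2 := is_pos_div_2 d). simpl in Hd2.
assert (Hb : ball 0 d (d / 2)).
{ unfold ball. cbn. unfold AbsRing_ball, abs, minus, plus, opp. cbn.
  rewrite Ropp_0, Rplus_0_r, Rabs_pos_eq; lra. }
apply Rbar_lt_le_trans with (d / 2); [exact Hd2|].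
apply Rbar_not_lt_le. intros Hlt.
apply (CV_disk_outside (fun n => E n / INR (Factorial.fact n)) (d / 2)).
- rewrite Rabs_pos_eq by lra. exact Hlt.
- apply ex_series_lim_0. eexists. exact (Hd _ Hb).
Qed.

Lemma is_euler_seq_unique E n : is_euler_seq E -> E n = euler n.
Proof.
intros HE.
assert (H : E n / INR (Factorial.fact n) = euler n / INR (Factorial.fact n)).
{ apply (PSeries_ext_recip (fun n => E n / INR (Factorial.fact n))
           (fun n => euler n / INR (Factorial.fact n))).
  - now apply is_euler_seq_radius.
  - apply is_euler_seq_radius, euler_spec.
  - generalize (filter_and _ _ HE euler_spec). apply filter_imp.
    intros t [H1 H2].
    rewrite (is_pseries_unique _ _ _ (proj2 (is_pseries_R _ _ _) H1)).
    now rewrite (is_pseries_unique _ _ _ (proj2 (is_pseries_R _ _ _) H2)). }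
apply Rmult_eq_reg_r with (/ INR (Factorial.fact n)); [exact H|].
apply Rinv_neq_0_compat, INR_fact_neq_0.
Qed.

(* Meaningful for s = 2 * k with k >= 1 only; at s = 0 the denominator
   vanishes. *)
Definition zetaE (s : nat) : R :=
  let k := Nat.div2 s in
  (-1) ^ (k + 1) * euler (2 * k) * PI ^ (2 * k + 1)
  / (4 * (1 - 4 ^ k) * INR (Factorial.fact (2 * k))).

(* Main.v *)
Require Import Defs.
From Stdlib Require Import Reals Lra Lia.
From Coquelicot Require Import Coquelicot.

Open Scope R_scope.

(** Write [zeta (2 n) / 16 ^ n] as the sum of [1 / (4 k) ^ (2 n)] over [k >= 1].
    All terms being nonnegative, the summations may be exchanged
    ([is_series_tonelli]), and the binomial generating function
    ([is_series_binom_odd]) evaluates the inner sum over [n].  The series of the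
    theorem becomes
    [1 / m * sum_k (1 / (4 k - 1) ^ m + (-1) ^ m / (4 k + 1) ^ m)],
    a sum over the odd integers at least 3, grouped in pairs
    ([is_series_zeta_binom]).

    For even [m] all signs agree, and the sum is the part of [zeta m] carried by
    the odd integers, minus its first term ([is_series_zeta_odd_part]).

    For odd [m = 2 k + 1] the signs alternate, and Euler's evaluation of
    [sum_n (-1) ^ n / (2 n + 1) ^ (2 k + 1)] is needed ([is_series_beta_odd]).
    It is proved by induction on [k], from Leibniz's series for [PI / 4].
    Repeated integration by parts writes the integral of
    [t ^ (2 k) / (2 k)! * cos ((2 n + 1) t)] over [[0, PI / 2]] as a combination of
    the powers [1 / (2 n + 1) ^ (2 i + 1)], [i <= k] ([is_RInt_even_divpow_cos]).
    Summed over [n] these integrals give [0] when [k >= 1]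
    ([is_series_even_divpow_cos]): the cosines add up to a Dirichlet kernel
    [sin (2 N t) / (2 sin t)], whose singularity the factor [t ^ (2 k)] removes, and
    a Riemann-Lebesgue estimate applies.  The linear relation thus obtained
    between the values of the beta function is the one that the Euler numbers
    satisfy as coefficients of the reciprocal of the hyperbolic cosine
    ([euler_recurrence]), once the powers of [PI / 2] are put in. *)

(** * Series of real numbers *)

Lemma pow_m1_mul_self n : (-1) ^ n * (-1) ^ n = 1.
Proof.
rewrite <- Rpow_mult_distr. replace (-1 * -1) with 1 by ring. apply pow1.
Qed.

Lemma is_series_pair (a : nat -> R) (l : R) :
  is_series a l ->
  is_series (fun n => a (2 * n)%nat + a (2 * n + 1)%nat) l.
Proof.
intros Ha.
assert (Hsub : is_lim_seq (fun n => sum_n a (2 * n + 1)) l).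
{ apply (is_lim_seq_subseq (sum_n a) l (fun n => (2 * n + 1)%nat)); [|exact Ha].
  intros P [N HN]. exists N. intros n Hn. apply HN. lia. }
refine (is_lim_seq_ext (fun n => sum_n a (2 * n + 1)) _ l _ Hsub).
intros n. induction n as [|n IH].
- simpl. rewrite sum_Sn, !sum_O. reflexivity.
- replace (2 * S n + 1)%nat with (S (S (2 * n + 1))) by lia.
  rewrite !sum_Sn, IH.
  replace (2 * S n)%nat with (S (2 * n + 1)) by lia.
  replace (S (2 * n + 1) + 1)%nat with (S (S (2 * n + 1))) by lia.
  unfold plus; simpl. ring.
Qed.

Lemma is_series_sum_n (a : nat -> nat -> R) (l : nat -> R) (N : nat) :
  (forall i, (i <= N)%nat -> is_series (a i) (l i)) ->
  is_series (fun k => sum_n (fun i => a i k) N) (sum_n l N).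
Proof.
induction N as [|N IH]; intros H.
- rewrite sum_O.
  apply (is_series_ext (a 0%nat)); [|now apply H].
  intros k. now rewrite sum_O.
- rewrite sum_Sn.
  apply (is_series_ext
           (fun k => plus (sum_n (fun i => a i k) N) (a (S N) k))).
  + intros k. now rewrite sum_Sn.
  + apply (is_series_plus _ (a (S N)) _ (l (S N))); 
      [apply IH; intros; apply H; lia | apply H; lia].
Qed.

Lemma sum_n_le_series (a : nat -> R) (l : R) (N : nat) :
  (forall n, 0 <= a n) -> is_series a l -> sum_n a N <= l.
Proof.
intros Ha Hl.
apply (is_lim_seq_incr_compare (sum_n a) l); [exact Hl|].
intros n. rewrite sum_Sn. unfold plus; simpl. specialize (Ha (S n)). lra.
Qed.

(** Both inequalities between the two iterated sums compare a finite block with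
    a full sum: the partial sums over [n] are at most [l] after exchanging a
    finite sum with a series, and every [sum_n c K] is the limit over [N] of
    block sums dominated by the partial sums of the rows.  The hypotheses force
    the rows to converge, since [a n k <= c k]. *)
Lemma is_series_tonelli (a : nat -> nat -> R) (c : nat -> R) (l : R) :
  (forall n k, 0 <= a n k) ->
  (forall k, is_series (fun n => a n k) (c k)) ->
  is_series c l ->
  is_series (fun n => Series (a n)) l.
Proof.
intros Ha Hc Hl.
assert (Hexc : ex_series c) by now exists l.
assert (Hrow : forall n, is_series (a n) (Series (a n))).
{ intros n. apply Series_correct.
  apply (@ex_series_le _ R_CompleteNormedModule (a n) c); [|exact Hexc].
  intros k. unfold norm; simpl. unfold abs; simpl.
  rewrite Rabs_pos_eq by apply Ha.
  apply Rle_trans with (sum_n (fun n => a n k) n).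
  - destruct n as [|n]; [rewrite sum_O; lra|].
    rewrite sum_Sn. unfold plus; simpl.
    assert (H : 0 <= sum_n (fun n => a n k) n); [|lra].
    rewrite sum_n_Reals. apply cond_pos_sum. intros; apply Ha.
  - apply sum_n_le_series; [intros; apply Ha | apply Hc]. }
assert (Hrow0 : forall n, 0 <= Series (a n)).
{ intros n.
  apply Rle_trans with (sum_n (a n) 0); [rewrite sum_O; apply Ha|].
  apply sum_n_le_series; [intros; apply Ha | apply Hrow]. }
assert (Hub : forall N, sum_n (fun n => Series (a n)) N <= l).
{ intros N.
  rewrite <- (is_series_unique _ _
    (is_series_sum_n a (fun n => Series (a n)) N (fun i _ => Hrow i))).
  rewrite <- (is_series_unique _ _ Hl).
  apply Series_le; [|exact Hexc]. intros k. split.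
  - rewrite sum_n_Reals. apply cond_pos_sum. intros; apply Ha.
  - apply (sum_n_le_series (fun n => a n k)); [intros; apply Ha | apply Hc]. }
destruct (ex_finite_lim_seq_incr (sum_n (fun n => Series (a n))) l) as [l' Hl'].
{ intros n. rewrite sum_Sn. unfold plus; simpl. generalize (Hrow0 (S n)). lra. }
{ exact Hub. }
replace l with l'; [exact Hl'|].
apply Rle_antisym.
- exact (is_lim_seq_le _ _ l' l Hub Hl' (is_lim_seq_const l)).
- apply (is_lim_seq_le (sum_n c) (fun _ => l') l l');
    [|exact Hl | apply is_lim_seq_const].
  intros K.
  apply (is_lim_seq_le
           (sum_n (fun n => sum_n (a n) K)) (sum_n (fun n => Series (a n)))
           (sum_n c K) l'); [| |exact Hl'].
  + intros N. rewrite !sum_n_Reals. apply sum_Rle. intros n _.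
    apply sum_n_le_series; [intros; apply Ha | apply Hrow].
  + exact (is_series_sum_n (fun k n => a n k) c K (fun k _ => Hc k)).
Qed.

(** * Binomial generating functions *)

Lemma binom_n_0 n : binom n 0 = 1.
Proof.
unfold binom, Binomial.C. simpl. rewrite Nat.sub_0_r. field. apply INR_fact_neq_0.
Qed.

Lemma binom_0_S p : binom 0 (S p) = 0.
Proof. reflexivity. Qed.

Lemma binom_pascal n p : binom (S n) (S p) = binom n p + binom n (S p).
Proof.
unfold binom.
destruct (Nat.leb_spec (S p) (S n)), (Nat.leb_spec p n), (Nat.leb_spec (S p) n);
  try lia; try lra.
- symmetry. apply pascal. lia.
- replace p with n by lia. unfold Binomial.C. rewrite !Nat.sub_diag.
  simpl (Factorial.fact 0). simpl (INR 1). field.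
  split; apply INR_fact_neq_0.
Qed.

Lemma binom_nonneg n p : 0 <= binom n p.
Proof.
unfold binom. destruct (p <=? n)%nat; [|lra].
unfold Binomial.C. apply Rlt_le, Rdiv_lt_0_compat; [apply INR_fact_lt_0|].
apply Rmult_lt_0_compat; apply INR_fact_lt_0.
Qed.

Lemma binom_absorption n p :
  INR (S p) * binom (S n) (S p) = INR (S n) * binom n p.
Proof.
unfold binom. simpl Nat.leb.
destruct (Nat.leb_spec p n); [|ring].
unfold Binomial.C. rewrite !fact_simpl, !mult_INR. simpl (S n - S p)%nat.
field. repeat split; try apply INR_fact_neq_0. apply not_0_INR. lia.
Qed.

(** One term of the binomial expansion of [(1 + y) ^ n]; it makes
    [binom n p * x ^ n] geometrically small as soon as [(1 + y) * Rabs x < 1]. *)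
Lemma binom_mul_pow_le n p y : 0 <= y -> binom n p * y ^ p <= (1 + y) ^ n.
Proof.
intros Hy. revert p. induction n as [|n IH]; intros [|p].
- rewrite binom_n_0. simpl. lra.
- rewrite binom_0_S. simpl. lra.
- rewrite binom_n_0. simpl (y ^ 0). rewrite Rmult_1_r. apply pow_R1_Rle. lra.
- rewrite binom_pascal. specialize (IH p) as H1. specialize (IH (S p)) as H2.
  simpl in *. nra.
Qed.

Lemma ex_series_binom p x :
  Rabs x < 1 -> ex_series (fun n => binom n p * x ^ n).
Proof.
intros Hx. assert (Hx0 := Rabs_pos x).
(* Any y > 0 with (1 + y) * |x| < 1 would do. *)
set (y := (1 - Rabs x) / 2). assert (Hy : 0 < y) by (unfold y; lra).
assert (Hyp : 0 < y ^ p) by now apply pow_lt.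
apply (@ex_series_le _ R_CompleteNormedModule _
         (fun n => / y ^ p * ((1 + y) * Rabs x) ^ n)).
- intros n. unfold norm; simpl. unfold abs; simpl.
  rewrite Rabs_mult, (Rabs_pos_eq (binom n p)) by apply binom_nonneg.
  rewrite <- RPow_abs, Rpow_mult_distr, <- Rmult_assoc.
  apply Rmult_le_compat_r; [apply pow_le, Rabs_pos|].
  apply (Rmult_le_reg_r (y ^ p)); [exact Hyp|].
  replace (/ y ^ p * (1 + y) ^ n * y ^ p) with ((1 + y) ^ n) by (field; lra).
  apply binom_mul_pow_le. lra.
- apply (ex_series_scal_l (/ y ^ p) (fun n => ((1 + y) * Rabs x) ^ n)).
  eexists. apply is_series_geom.
  rewrite Rabs_pos_eq; unfold y; nra.
Qed.

(** By Pascal's rule the sum [G] for [S p] satisfies [G = x * F + x * G], with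
    [F] the sum for [p]; solving for [G] is legitimate because the series is
    already known to converge. *)
Lemma is_series_binom p x :
  Rabs x < 1 ->
  is_series (fun n => binom n p * x ^ n) (x ^ p / (1 - x) ^ (p + 1)).
Proof.
intros Hx. assert (Hx1 : 1 - x <> 0) by (apply Rabs_def2 in Hx; lra).
induction p as [|p IH].
- replace (x ^ 0 / (1 - x) ^ (0 + 1)) with (/ (1 - x)) by (simpl; field; lra).
  apply (is_series_ext (fun n => x ^ n)); [|now apply is_series_geom].
  intros n. rewrite binom_n_0. symmetry. apply Rmult_1_l.
- assert (HG := Series_correct _ (ex_series_binom (S p) x Hx)).
  set (G := Series _) in HG.
  assert (H1 : is_series (fun n => binom (S n) (S p) * x ^ S n) G).
  { apply (is_series_incr_1 (fun n => binom n (S p) * x ^ n)).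
    rewrite binom_0_S, Rmult_0_l.
    change (plus G 0) with (G + 0). rewrite Rplus_0_r. exact HG. }
  assert (H2 : is_series (fun n => binom (S n) (S p) * x ^ S n)
                 (x * (x ^ p / (1 - x) ^ (p + 1)) + x * G)).
  { apply (is_series_ext
      (fun n => plus (x * (binom n p * x ^ n)) (x * (binom n (S p) * x ^ n)))).
    - intros n. rewrite binom_pascal. unfold plus; simpl. ring.
    - exact (is_series_plus _ _ _ _ (is_series_scal_l x _ _ IH)
               (is_series_scal_l x _ _ HG)). }
  assert (H := is_series_unique _ _ H2).
  rewrite (is_series_unique _ _ H1) in H.
  replace (x ^ S p / (1 - x) ^ (S p + 1)) with G; [exact HG|].
  apply (Rmult_eq_reg_r (1 - x)); [|exact Hx1].
  replace (G * (1 - x)) with (G - x * G) by ring. rewrite H at 1.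
  simpl. field. split; [now apply pow_nonzero | exact Hx1].
Qed.

(** The odd part of the previous generating function, multiplied by [x].  At
    [x = 1 / (4 k)] the two quotients are [1 / (4 k - 1)] and [1 / (4 k + 1)],
    which is how the odd integers enter. *)
Lemma is_series_binom_odd p x :
  Rabs x < 1 ->
  is_series (fun n => binom (2 * n + 1) p * x ^ (2 * n + 2))
    (((x / (1 - x)) ^ S p + (-1) ^ S p * (x / (1 + x)) ^ S p) / 2).
Proof.
intros Hx.
assert (H1 := is_series_binom p x Hx).
assert (H2 : Rabs (- x) < 1) by now rewrite Rabs_Ropp.
apply (is_series_binom p) in H2.
assert (H := is_series_pair _ _ (is_series_scal_l (x / 2) _ _
               (is_series_minus _ _ _ _ H1 H2))).
apply Rabs_def2 in Hx.
replace (_ / 2) with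
  (scal (x / 2) (plus (x ^ p / (1 - x) ^ (p + 1))
     (opp ((- x) ^ p / (1 - - x) ^ (p + 1))))).
- revert H. apply is_series_ext. intros n.
  unfold scal, plus, opp; simpl. unfold mult; simpl.
  replace (- x) with (-1 * x) by ring.
  rewrite !Rpow_mult_distr, !Nat.add_0_r.
  replace (n + n + 1)%nat with (S (2 * n)) by lia.
  replace (n + n)%nat with (2 * n)%nat by lia.
  replace (2 * n + 2)%nat with (S (S (2 * n))) by lia.
  rewrite pow_1_odd, pow_1_even. simpl. field.
- unfold scal, plus, opp; simpl. unfold mult; simpl.
  replace (- x) with (-1 * x) by ring.
  replace (1 - -1 * x) with (1 + x) by ring.
  unfold Rdiv. rewrite !Rpow_mult_distr, !pow_inv, Nat.add_1_r. simpl.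
  field. repeat split; try apply pow_nonzero; lra.
Qed.

(** * Cosine integrals of even monomials *)

(** A quantitative Riemann-Lebesgue lemma.  After one integration by parts the
    boundary terms contribute at most [(h a + h b) / M] and, [h'] being
    nonnegative, the remaining integral at most [(h b - h a) / M]. *)
Lemma RInt_mul_sin_le (h h' : R -> R) (a b M v : R) :
  a <= b -> 0 < M ->
  (forall t, a <= t <= b -> is_derive h t (h' t)) ->
  (forall t, a <= t <= b -> continuous h' t) ->
  (forall t, a <= t <= b -> 0 <= h' t) ->
  0 <= h a ->
  is_RInt (fun t => h t * sin (M * t)) a b v ->
  Rabs v <= 2 * h b / M.
Proof.
intros Hab HM Hd Hc Hpos Ha Hv.
assert (Hh : is_RInt h' a b (h b - h a)).
{ apply (is_RInt_derive h h'); rewrite Rmin_left, Rmax_right by assumption;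
    assumption. }
assert (Hhb : h a <= h b).
{ assert (H0 := is_RInt_const a b 0).
  assert (H := is_RInt_le (fun _ => 0) h' a b _ _ Hab H0 Hh
                 (fun x Hx => Hpos x (conj (Rlt_le _ _ (proj1 Hx)) (Rlt_le _ _ (proj2 Hx))))).
  unfold scal in H; simpl in H; unfold mult in H; simpl in H. lra. }
assert (Hcos : forall t, Rabs (cos (M * t)) <= 1).
{ intros t. apply Rabs_le. apply COS_bound. }
assert (Hparts : is_RInt (fun t => h' t * (- cos (M * t) / M) + h t * sin (M * t)) a b
          (h b * (- cos (M * b) / M) - h a * (- cos (M * a) / M))).
{ apply (is_RInt_derive (fun t => h t * (- cos (M * t) / M))
    (fun t => h' t * (- cos (M * t) / M) + h t * sin (M * t)));
    rewrite Rmin_left, Rmax_right by assumption; intros t Ht.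
  - apply (is_derive_mult h (fun t => - cos (M * t) / M) t (h' t) (sin (M * t))).
    + now apply Hd.
    + auto_derive; [exact I | field; lra].
    + intros; apply Rmult_comm.
  - apply (continuous_plus (fun t => h' t * (- cos (M * t) / M))
             (fun t => h t * sin (M * t))).
    + apply (continuous_mult h' (fun t => - cos (M * t) / M)); [now apply Hc|].
      apply (ex_derive_continuous (fun t => - cos (M * t) / M)). auto_derive. lra.
    + apply (continuous_mult h (fun t => sin (M * t))).
      * apply (ex_derive_continuous h). eexists. now apply Hd.
      * apply (ex_derive_continuous (fun t => sin (M * t))). auto_derive. exact I. }
assert (Hrest := is_RInt_minus _ _ _ _ _ _ Hparts Hv).
assert (Hbound := is_RInt_scal _ _ _ (/ M) _ Hh).
assert (Hle : Rabs (h b * (- cos (M * b) / M) - h a * (- cos (M * a) / M) - v)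
              <= / M * (h b - h a)).
{ apply (norm_RInt_le _ _ a b _ _ Hab) with (2 := Hrest) (3 := Hbound).
  intros t Ht.
  change (Rabs (h' t * (- cos (M * t) / M) + h t * sin (M * t) - h t * sin (M * t))
          <= / M * h' t).
  replace (_ - _) with (/ M * (h' t * - cos (M * t))) by (field; lra).
  assert (0 < / M) by now apply Rinv_0_lt_compat.
  rewrite !Rabs_mult, Rabs_Ropp, (Rabs_pos_eq (/ M)) by lra.
  rewrite (Rabs_pos_eq (h' t)) by now apply Hpos.
  apply Rmult_le_compat_l; [lra|]. rewrite <- (Rmult_1_r (h' t)) at 2.
  apply Rmult_le_compat_l; [now apply Hpos | apply Hcos]. }
assert (Hca := COS_bound (M * a)). assert (Hcb := COS_bound (M * b)).
apply Rabs_le_between in Hle.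
assert (HI : 0 < / M) by now apply Rinv_0_lt_compat.
unfold Rdiv in *.
assert (Ea : - (h a * / M) <= h a * (- cos (M * a) * / M) <= h a * / M).
{ assert (0 <= h a * / M) by (apply Rmult_le_pos; lra).
  replace (h a * (- cos (M * a) * / M)) with (h a * / M * - cos (M * a)) by ring. nra. }
assert (Eb : - (h b * / M) <= h b * (- cos (M * b) * / M) <= h b * / M).
{ assert (0 <= h b * / M) by (apply Rmult_le_pos; lra).
  replace (h b * (- cos (M * b) * / M)) with (h b * / M * - cos (M * b)) by ring. nra. }
apply Rabs_le. lra.
Qed.

Definition even_divpow (k : nat) (t : R) : R := t ^ (2 * k) / INR (Factorial.fact (2 * k)).

(** Integrating by parts twice lowers [k] by one.  At [PI / 2] the cosine of an
    odd multiple vanishes and the sine is [(-1) ^ n]; at [0] both the sine and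
    the odd powers of [t] vanish, so only the even derivatives at [PI / 2]
    remain. *)
Lemma is_RInt_even_divpow_cos (k n : nat) :
  is_RInt (fun t => even_divpow k t * cos ((2 * INR n + 1) * t)) 0 (PI / 2)
    ((-1) ^ n * sum_f_R0 (fun i => (-1) ^ i * even_divpow (k - i) (PI / 2)
                            / (2 * INR n + 1) ^ (2 * i + 1)) k).
Proof.
set (q := 2 * INR n + 1).
assert (Hq : 0 < q) by (unfold q; generalize (pos_INR n); lra).
assert (Hsin : sin (q * (PI / 2)) = (-1) ^ n).
{ unfold q. clear. induction n as [|n IH].
  - simpl. replace ((2 * 0 + 1) * (PI / 2)) with (PI / 2) by field. apply sin_PI2.
  - rewrite S_INR. replace ((2 * (INR n + 1) + 1) * (PI / 2))
      with ((2 * INR n + 1) * (PI / 2) + PI) by field.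
    rewrite neg_sin, IH. simpl. ring. }
assert (Hcos : cos (q * (PI / 2)) = 0).
{ apply cos_eq_0_1. exists (Z.of_nat n). rewrite <- INR_IZR_INZ. unfold q. field. }
induction k as [|k IH].
- evar_last.
  + apply (is_RInt_derive (fun t => sin (q * t) / q)).
    * intros t _. unfold even_divpow; simpl. auto_derive; [exact I | field; lra].
    * intros t _.
      apply (ex_derive_continuous (fun t => even_divpow 0 t * cos (q * t))).
      unfold even_divpow. auto_derive. exact I.
  + rewrite Hsin. unfold even_divpow, minus, plus, opp; simpl.
    rewrite Rmult_0_r, sin_0. field. lra.
- (* The antiderivative collects both boundary terms, so that the integral for
     S k plus that for k divided by q ^ 2 has a closed form. *)
  assert (Hparts : is_RInt
    (fun t => even_divpow (S k) t * cos (q * t) + / q ^ 2 * (even_divpow k t * cos (q * t)))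
    0 (PI / 2) ((-1) ^ n * even_divpow (S k) (PI / 2) / q)).
  { evar_last.
    - apply (is_RInt_derive
        (fun t => even_divpow (S k) t * (sin (q * t) / q)
                  + t ^ S (2 * k) / INR (Factorial.fact (S (2 * k))) * (cos (q * t) / q ^ 2))
        (fun t => even_divpow (S k) t * cos (q * t) + / q ^ 2 * (even_divpow k t * cos (q * t)))).
      + intros t _. unfold even_divpow.
        replace (2 * S k)%nat with (S (S (2 * k))) by lia.
        rewrite !fact_simpl, !mult_INR, !S_INR.
        assert (H0 := pos_INR (2 * k)). assert (H1 := INR_fact_neq_0 (2 * k)).
        revert H0 H1. generalize (2 * k)%nat as p. intros p H0 H1.
        auto_derive; [exact I|].
        change (match p with O => 1 | S _ => INR p + 1 end) with (INR (S p)).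
        rewrite S_INR, <- !tech_pow_Rmult. field. repeat split; lra.
      + intros t _.
        apply (ex_derive_continuous
          (fun t => even_divpow (S k) t * cos (q * t) + / q ^ 2 * (even_divpow k t * cos (q * t)))).
        unfold even_divpow. auto_derive. repeat split; exact I.
    - rewrite Hsin, Hcos. unfold even_divpow, minus, plus, opp; simpl.
      rewrite Rmult_0_r, sin_0, !Rmult_0_l. unfold Rdiv. ring. }
  assert (H := is_RInt_minus _ _ _ _ _ _ Hparts (is_RInt_scal _ _ _ (/ q ^ 2) _ IH)).
  evar_last.
  + eapply is_RInt_ext; [|exact H]. intros t _.
    unfold minus, plus, opp, scal; simpl. unfold mult; simpl. ring.
  + match goal with |- minus ?A (scal ?c ?X) = ?Y => change (A - c * X = Y) end.
    rewrite (decomp_sum _ (S k)) by lia. simpl pred.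
    rewrite Rmult_plus_distr_l, Nat.sub_0_r. unfold Rminus.
    apply (f_equal2 Rplus).
    * simpl. field. lra.
    * rewrite <- Rmult_assoc, (Rmult_comm _ ((-1) ^ n)), Rmult_assoc, Ropp_mult_distr_r.
      f_equal. rewrite Ropp_mult_distr_l, scal_sum. apply sum_eq. intros i _.
      replace (2 * S i + 1)%nat with (S (S (2 * i + 1))) by lia.
      rewrite <- !tech_pow_Rmult. simpl (S k - S i)%nat.
      field. split; [apply pow_nonzero; lra | lra].
Qed.

(** The Dirichlet kernel for odd frequencies, by telescoping. *)
Lemma sum_cos_odd N t :
  2 * sin t * sum_n (fun n => cos ((2 * INR n + 1) * t)) N
  = sin (2 * INR (S N) * t).
Proof.
induction N as [|N IH].
- rewrite sum_O. simpl. replace ((2 * 0 + 1) * t) with t by ring.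
  replace (2 * 1 * t) with (2 * t) by ring. rewrite sin_2a. ring.
- rewrite sum_Sn.
  change (2 * sin t * (sum_n (fun n => cos ((2 * INR n + 1) * t)) N
           + cos ((2 * INR (S N) + 1) * t)) = sin (2 * INR (S (S N)) * t)).
  rewrite Rmult_plus_distr_l, IH, (S_INR (S N)).
  set (x := INR (S N)).
  replace (2 * x * t) with ((2 * x + 1) * t - t) by ring.
  replace (2 * (x + 1) * t) with ((2 * x + 1) * t + t) by ring.
  rewrite sin_minus, sin_plus. ring.
Qed.

Lemma sin_ge_mul_cos t : 0 <= t <= PI / 2 -> t * cos t <= sin t.
Proof.
intros Ht.
destruct (MVT_gen (fun t => sin t - t * cos t) 0 t (fun t => t * sin t))
  as [c [Hc E]].
- intros x _. auto_derive; [exact I | ring].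
- intros x _. apply continuity_pt_filterlim.
  apply (ex_derive_continuous (fun t => sin t - t * cos t)). auto_derive. exact I.
- rewrite Rmin_left, Rmax_right in Hc by lra. rewrite sin_0 in E.
  assert (0 <= sin c) by (apply sin_ge_0; lra).
  assert (0 <= c * sin c * (t - 0)) by (repeat apply Rmult_le_pos; lra). lra.
Qed.

Lemma is_RInt_sum_n (f : nat -> R -> R) (v : nat -> R) a b N :
  (forall n, is_RInt (f n) a b (v n)) ->
  is_RInt (fun t => sum_n (fun n => f n t) N) a b (sum_n v N).
Proof.
intros H. induction N as [|N IH].
- rewrite sum_O. apply (is_RInt_ext (f 0%nat)); [|apply H].
  intros t _. now rewrite sum_O.
- rewrite sum_Sn.
  apply (is_RInt_ext (fun t => plus (sum_n (fun n => f n t) N) (f (S N) t))).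
  + intros t _. now rewrite sum_Sn.
  + now apply @is_RInt_plus.
Qed.

(** The closed form of the Dirichlet kernel has the denominator [2 sin t], so the
    interval is cut at [d = 1 / (N + 1)].  On [[0, d]] the trivial bound [N + 1] of the
    kernel is absorbed by one factor [t <= d], and the length is [d].  On
    [[d, PI / 2]] the function [t ^ (2 k + 2) / (2 sin t)] is nondecreasing,
    because [t cos t <= sin t], and the Riemann-Lebesgue bound applies.  The two
    terms of the bound come from these two intervals. *)
Lemma sum_even_monomial_cos_bound (k N : nat) (v : R) :
  is_RInt (fun t => t ^ (2 * S k) * sum_n (fun n => cos ((2 * INR n + 1) * t)) N)
    0 (PI / 2) v ->
  Rabs v <= (1 + (PI / 2) ^ (2 * S k) / 2) / INR (S N).
Proof.
intros Hv. set (D := fun t => sum_n (fun n => cos ((2 * INR n + 1) * t)) N).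
set (f := fun t => t ^ (2 * S k) * D t).
change (is_RInt f 0 (PI / 2) v) in Hv.
assert (HPI := PI2_1).
assert (HN : 1 <= INR (S N)) by (rewrite S_INR; generalize (pos_INR N); lra).
set (d := / INR (S N)).
assert (Hd : 0 < d <= 1).
{ unfold d. split; [apply Rinv_0_lt_compat; lra|].
  rewrite <- Rinv_1. apply Rinv_le_contravar; lra. }
assert (HD : forall t, Rabs (D t) <= INR (S N)).
{ intros t. unfold D. clear. induction N as [|N IH].
  - rewrite sum_O. simpl (INR 1). apply Rabs_le, COS_bound.
  - rewrite sum_Sn, (S_INR (S N)). eapply Rle_trans; [apply Rabs_triang|].
    apply Rplus_le_compat; [exact IH | apply Rabs_le, COS_bound]. }
assert (E1 : ex_RInt f 0 d).
{ apply (ex_RInt_Chasles_1 f 0 d (PI / 2)); [lra | now exists v]. }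
assert (E2 : ex_RInt f d (PI / 2)).
{ apply (ex_RInt_Chasles_2 f 0 d (PI / 2)); [lra | now exists v]. }
destruct E1 as [v1 H1], E2 as [v2 H2].
assert (Ev : v = v1 + v2).
{ rewrite <- (is_RInt_unique _ _ _ _ Hv).
  exact (is_RInt_unique _ _ _ _ (is_RInt_Chasles _ _ _ _ _ _ H1 H2)). }
assert (B1 : Rabs v1 <= d).
{ assert (H : Rabs v1 <= (d - 0) * 1).
  { apply (norm_RInt_le_const f 0 d v1 1); [lra| |exact H1].
    intros t Ht. change (Rabs (f t) <= 1). unfold f.
    rewrite Rabs_mult, <- RPow_abs, (Rabs_pos_eq t) by lra.
    replace (2 * S k)%nat with (S (S (2 * k))) by lia. rewrite <- !tech_pow_Rmult.
    assert (Hp : 0 <= t ^ (2 * k) <= 1).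
    { split; [apply pow_le; lra|].
      rewrite <- (pow1 (2 * k)). apply pow_incr. lra. }
    assert (Hdd : t * Rabs (D t) <= 1).
    { apply Rle_trans with (d * INR (S N)).
      - apply Rmult_le_compat; [lra | apply Rabs_pos | lra | apply HD].
      - unfold d. rewrite Rinv_l; lra. }
    replace (_ * Rabs (D t)) with (t * t ^ (2 * k) * (t * Rabs (D t))) by ring.
    rewrite <- (Rmult_1_r 1).
    apply Rmult_le_compat; [| |rewrite <- (Rmult_1_r 1); apply Rmult_le_compat; lra|lra].
    - apply Rmult_le_pos; lra.
    - apply Rmult_le_pos; [lra | apply Rabs_pos]. }
  lra. }
assert (Hs : forall t, d <= t <= PI / 2 -> 0 < sin t).
{ intros t Ht. apply sin_gt_0; lra. }
assert (B2 : Rabs v2 <= 2 * ((PI / 2) ^ (2 * S k) / (2 * sin (PI / 2))) / (2 * INR (S N))).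
{ apply (RInt_mul_sin_le (fun t => t ^ (2 * S k) / (2 * sin t))
    (fun t => t ^ (2 * k + 1) * (INR (2 * S k) * sin t - t * cos t) / (2 * sin t ^ 2))
    d (PI / 2)); try lra.
  - intros t Ht. specialize (Hs t Ht).
    replace (2 * S k)%nat with (S (2 * k + 1)) by lia.
    generalize (2 * k + 1)%nat as p. intros p.
    auto_derive; [lra|].
    change (match p with O => 1 | S _ => INR p + 1 end) with (INR (S p)).
    rewrite <- tech_pow_Rmult. field. lra.
  - intros t Ht. specialize (Hs t Ht).
    apply (ex_derive_continuous (fun t => t ^ (2 * k + 1) *
      (INR (2 * S k) * sin t - t * cos t) / (2 * sin t ^ 2))).
    auto_derive. assert (0 < sin t ^ 2) by (apply pow_lt; lra). lra.
  - intros t Ht. specialize (Hs t Ht).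
    apply Rdiv_le_0_compat; [|assert (0 < sin t ^ 2) by (apply pow_lt; lra); lra].
    apply Rmult_le_pos; [apply pow_le; lra|].
    assert (Ht' := sin_ge_mul_cos t ltac:(lra)).
    assert (1 <= INR (2 * S k)).
    { change 1 with (INR 1). apply le_INR. lia. }
    nra.
  - apply Rdiv_le_0_compat; [apply pow_le; lra|]. specialize (Hs d). lra.
  - apply (is_RInt_ext f); [|exact H2].
    rewrite Rmin_left, Rmax_right by lra. intros t Ht. unfold f, D.
    specialize (Hs t ltac:(lra)).
    rewrite <- sum_cos_odd.
    match goal with |- ?x = ?y => change (@eq R x y) end.
    field. lra. }
rewrite sin_PI2 in B2.
rewrite Ev. eapply Rle_trans; [apply Rabs_triang|].
replace (_ / INR (S N)) with
  (d + 2 * ((PI / 2) ^ (2 * S k) / (2 * 1)) / (2 * INR (S N))); [lra|].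
unfold d. generalize ((PI / 2) ^ (2 * S k)). intros P. field. lra.
Qed.

(** The exponent [S k >= 1] matters: for the exponent [0] the integral of the
    kernel does not tend to [0], its limit being [PI / 4]. *)
Lemma is_series_even_divpow_cos (k : nat) :
  is_series (fun n => (-1) ^ n * sum_f_R0 (fun i => (-1) ^ i * even_divpow (S k - i) (PI / 2)
                            / (2 * INR n + 1) ^ (2 * i + 1)) (S k)) 0.
Proof.
set (v := fun n : nat => _).
change (is_lim_seq (sum_n v) 0).
set (F := INR (Factorial.fact (2 * S k))).
assert (HF : 0 < F) by apply INR_fact_lt_0.
set (B := (1 + (PI / 2) ^ (2 * S k) / 2) / F).
assert (Hb : forall N, Rabs (sum_n v N) <= B * / INR (S N)).
{ intros N.
  assert (HN : INR (S N) <> 0) by (apply not_0_INR; lia).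
  assert (H := is_RInt_scal _ _ _ F _
    (is_RInt_sum_n _ v 0 (PI / 2) N (is_RInt_even_divpow_cos (S k)))).
  assert (H' : Rabs (F * sum_n v N) <= (1 + (PI / 2) ^ (2 * S k) / 2) / INR (S N)).
  { apply sum_even_monomial_cos_bound. revert H. apply is_RInt_ext. intros t _.
    transitivity (F * (even_divpow (S k) t * sum_n (fun n => cos ((2 * INR n + 1) * t)) N)).
    - apply (f_equal (Rmult F)). exact (sum_n_mult_l (K := R_Ring) _ _ _).
    - unfold even_divpow. fold F. match goal with |- ?x = ?y => change (@eq R x y) end.
      field. lra. }
  rewrite Rabs_mult, (Rabs_pos_eq F) in H' by lra.
  apply (Rmult_le_reg_l F); [exact HF|].
  replace (F * (B * / INR (S N))) with ((1 + (PI / 2) ^ (2 * S k) / 2) / INR (S N)); [exact H'|].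
  unfold B. field. split; lra. }
assert (Hlim : is_lim_seq (fun N => B * / INR (S N)) 0).
{ replace (Finite 0) with (Rbar_mult B (Finite 0)) by (simpl; f_equal; ring).
  apply is_lim_seq_scal_l.
  replace (Finite 0) with (Rbar_inv p_infty) by reflexivity.
  apply is_lim_seq_inv; [|discriminate].
  apply (is_lim_seq_incr_1 INR). apply is_lim_seq_INR. }
apply is_lim_seq_abs_0.
apply (is_lim_seq_le_le (fun _ => 0) _ (fun N => B * / INR (S N)));
  [|apply is_lim_seq_const | exact Hlim].
intros N. split; [apply Rabs_pos | apply Hb].
Qed.

(** * The recurrence of the Euler numbers *)

Lemma pseries_coef_unique (a b : nat -> R) (f : R -> R) :
  locally 0 (fun t => is_pseries a t (f t)) ->
  locally 0 (fun t => is_pseries b t (f t)) ->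
  forall n, a n = b n.
Proof.
assert (Hr : forall c, locally 0 (fun t => is_pseries c t (f t)) ->
               Rbar_lt 0 (CV_radius c)).
{ intros c [d Hd].
  assert (Hd2 := is_pos_div_2 d). simpl in Hd2.
  apply Rbar_lt_le_trans with (d / 2); [exact Hd2|].
  apply Rbar_not_lt_le. intros Hlt.
  apply (CV_disk_outside c (d / 2)).
  - rewrite Rabs_pos_eq by lra. exact Hlt.
  - apply ex_series_lim_0. eexists. apply is_pseries_R, Hd.
    change (Rabs (d / 2 - 0) < d). rewrite Rminus_0_r, Rabs_pos_eq; lra. }
intros Ha Hb n. apply PSeries_ext_recip; [now apply Hr | now apply Hr |].
generalize (filter_and _ _ Ha Hb). apply filter_imp. intros t [Hat Hbt].
now rewrite (is_pseries_unique _ _ _ Hat), (is_pseries_unique _ _ _ Hbt).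
Qed.

Lemma is_pseries_1 t : is_pseries (fun n => if (n =? 0)%nat then 1 else 0) t 1.
Proof.
apply is_pseries_R. apply (is_lim_seq_ext (fun _ => 1) _ 1); [|apply is_lim_seq_const].
intros N. induction N as [|N IH].
- rewrite sum_O. simpl. ring.
- rewrite sum_Sn, <- IH. change (1 = 1 + 0 * t ^ S N). ring.
Qed.

(** The defining expansion of the Euler numbers only holds near [0]; uniqueness
    of power series coefficients turns it into the Cauchy product relation. *)
Lemma euler_cosh_mult n :
  PS_mult (fun i => euler i / INR (Factorial.fact i)) cosh_coef n
  = if (n =? 0)%nat then 1 else 0.
Proof.
apply (pseries_coef_unique _ (fun n => if (n =? 0)%nat then 1 else 0) (fun _ => 1)).
- assert (Hr := is_euler_seq_radius euler euler_spec).
  set (e := fun i => euler i / INR (Factorial.fact i)) in *.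
  assert (Hlt : forall c, Rbar_lt 0 (CV_radius c) ->
            locally 0 (fun t => Rbar_lt (Rabs t) (CV_radius c))).
  { intros c Hc. destruct (CV_radius c) as [r| |]; [|now apply filter_forall|easy].
    exists (mkposreal r Hc). intros t Ht. change (Rabs (t - 0) < r) in Ht.
    now rewrite Rminus_0_r in Ht. }
  assert (Hc : Rbar_lt 0 (CV_radius cosh_coef)).
  { apply Rbar_lt_le_trans with 1; [simpl; lra | apply cosh_radius]. }
  generalize (filter_and _ _ euler_spec (filter_and _ _ (Hlt _ Hr) (Hlt _ Hc))).
  apply filter_imp. intros t [He [Het Hct]].
  assert (H := is_pseries_mult _ _ _ _ _ (proj2 (is_pseries_R e _ _) He)
                 (is_pseries_cosh t) Het Hct).
  replace 1 with (2 / (exp t + exp (- t)) * ((exp t + exp (- t)) / 2)); [exact H|].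
  assert (H1 := exp_pos t). assert (H2 := exp_pos (- t)). field. lra.
- apply filter_forall. exact is_pseries_1.
Qed.

Lemma cosh_coef_even n : cosh_coef (2 * n) = / INR (Factorial.fact (2 * n)).
Proof.
unfold cosh_coef. rewrite pow_1_even. field. apply INR_fact_neq_0.
Qed.

Lemma cosh_coef_odd n : cosh_coef (S (2 * n)) = 0.
Proof. unfold cosh_coef. rewrite pow_1_odd. unfold Rdiv. ring. Qed.

Lemma sum_f_R0_even (f : nat -> R) n :
  (forall i, (i < n)%nat -> f (S (2 * i)) = 0) ->
  sum_f_R0 f (2 * n) = sum_f_R0 (fun i => f (2 * i)%nat) n.
Proof.
induction n as [|n IH]; intros H; [reflexivity|].
replace (2 * S n)%nat with (S (S (2 * n))) by lia.
rewrite !tech5, IH, H by (intros; try apply H; lia).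
replace (2 * S n)%nat with (S (S (2 * n))) by lia. ring.
Qed.

Lemma euler_recurrence k :
  sum_f_R0 (fun i => euler (2 * i) / INR (Factorial.fact (2 * i))
                     / INR (Factorial.fact (2 * (S k - i)))) (S k) = 0.
Proof.
assert (H := euler_cosh_mult (2 * S k)). unfold PS_mult in H.
rewrite sum_f_R0_even in H.
- etransitivity; [|exact H]. apply sum_eq. intros i Hi.
  replace (2 * S k - 2 * i)%nat with (2 * (S k - i))%nat by lia.
  now rewrite cosh_coef_even.
- intros i Hi. replace (2 * S k - S (2 * i))%nat with (S (2 * (k - i))) by lia.
  rewrite cosh_coef_odd. ring.
Qed.

Lemma euler_0 : euler 0 = 1.
Proof.
assert (H := euler_cosh_mult 0). unfold PS_mult, cosh_coef in H. simpl in H. lra.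
Qed.

(** * The odd values of Dirichlet's beta function *)

Lemma is_series_leibniz : is_series (fun n => (-1) ^ n / (2 * INR n + 1)) (PI / 4).
Proof.
rewrite <- Alt_PI_eq. unfold Alt_PI. destruct exist_PI as [l Hl].
replace (4 * l / 4) with l by field.
apply is_series_Reals. intros eps Heps. destruct (Hl eps Heps) as [N HN].
exists N. intros n Hn. specialize (HN n Hn).
rewrite (sum_eq _ (tg_alt PI_tg)); [exact HN|].
intros i _. unfold tg_alt, PI_tg. rewrite plus_INR, mult_INR. reflexivity.
Qed.

(** Euler's closed form of [1 - 1 / 3 ^ (2 k + 1) + 1 / 5 ^ (2 k + 1) - ...], the
    value at [2 k + 1] of Dirichlet's beta function. *)
Definition beta_odd (k : nat) : R :=
  (-1) ^ k * (euler (2 * k) / INR (Factorial.fact (2 * k))) * (PI / 2) ^ (2 * k) * (PI / 4).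

Lemma beta_odd_recurrence k :
  sum_f_R0 (fun i => (-1) ^ i * even_divpow (S k - i) (PI / 2) * beta_odd i) (S k) = 0.
Proof.
assert (H := f_equal (Rmult ((PI / 2) ^ (2 * S k) * (PI / 4))) (euler_recurrence k)).
rewrite Rmult_0_r, scal_sum in H.
etransitivity; [|exact H]. apply sum_eq. intros i Hi. unfold even_divpow, beta_odd.
replace (2 * S k)%nat with (2 * (S k - i) + 2 * i)%nat by lia. rewrite pow_add.
assert (H1 := pow_m1_mul_self i).
unfold Rdiv. transitivity ((-1) ^ i * (-1) ^ i * ((PI * / 2) ^ (2 * (S k - i)) *
  / INR (Factorial.fact (2 * (S k - i))) *
  (euler (2 * i) * / INR (Factorial.fact (2 * i))) * (PI * / 2) ^ (2 * i) * (PI * / 4))).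
- ring.
- rewrite H1. ring.
Qed.

(** Summing [is_RInt_even_divpow_cos] over [n] gives a linear combination of the
    series for the exponents [2 i + 1], [i <= S k], whose sum is [0] and whose
    last coefficient is [(-1) ^ S k].  Solving for the last series proves its
    convergence and, by [beta_odd_recurrence], gives its value. *)
Lemma is_series_beta_odd k :
  is_series (fun n => (-1) ^ n / (2 * INR n + 1) ^ (2 * k + 1)) (beta_odd k).
Proof.
induction k as [[|k] IH] using (well_founded_induction PeanoNat.Nat.lt_wf_0).
- replace (beta_odd 0) with (PI / 4).
  + apply (is_series_ext (fun n => (-1) ^ n / (2 * INR n + 1)));
      [|exact is_series_leibniz].
    intros n. simpl. now rewrite Rmult_1_r.
  + unfold beta_odd. simpl. rewrite euler_0. field.
- assert (Hlow := is_series_sum_n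
    (fun i n => (-1) ^ i * even_divpow (S k - i) (PI / 2)
                * ((-1) ^ n / (2 * INR n + 1) ^ (2 * i + 1)))
    (fun i => (-1) ^ i * even_divpow (S k - i) (PI / 2) * beta_odd i) k
    (fun i Hi => is_series_scal_l _ _ _ (IH i (proj2 (Nat.lt_succ_r i k) Hi)))).
  assert (H := is_series_scal_l ((-1) ^ S k) _ _
                 (is_series_minus _ _ _ _ (is_series_even_divpow_cos k) Hlow)).
  assert (H1 := pow_m1_mul_self (S k)).
  assert (H0 : even_divpow (S k - S k) (PI / 2) = 1).
  { rewrite Nat.sub_diag. unfold even_divpow. simpl. field. }
  match type of H with is_series _ ?l => replace (beta_odd (S k)) with l end.
  + revert H. apply is_series_ext. intros n.
    match goal with |- scal ?c (plus ?x (opp ?y)) = ?z =>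
      change (c * (x - y) = z) end.
    rewrite sum_n_Reals, tech5, H0.
    (* The i <= k parts cancel, leaving ((-1) ^ S k) ^ 2 = 1 times the term. *)
    rewrite Rmult_plus_distr_l, scal_sum.
    match goal with |- _ * (?s + _ - ?s') = _ => replace s with s' end.
    * match goal with |- _ * (?s + ?x - ?s) = ?z =>
        transitivity ((-1) ^ S k * (-1) ^ S k * z) end.
      -- unfold Rdiv. ring.
      -- rewrite H1. ring.
    * apply sum_eq. intros i _. unfold Rdiv. ring.
  + match goal with |- scal ?c (plus ?x (opp ?y)) = ?z =>
      change (c * (x - y) = z) end.
    assert (Hrec := beta_odd_recurrence k).
    rewrite tech5, H0 in Hrec. rewrite sum_n_Reals.
    replace (sum_f_R0 _ k) with (- ((-1) ^ S k * 1 * beta_odd (S k))) by lra.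
    transitivity ((-1) ^ S k * (-1) ^ S k * beta_odd (S k)); [ring|].
    rewrite H1. ring.
Qed.

Lemma beta_odd_zetaE k :
  (1 <= k)%nat -> zetaE (2 * k) * (1 - 1 / 2 ^ (2 * k)) = beta_odd k.
Proof.
intros Hk. unfold zetaE, beta_odd. rewrite Nat.div2_double.
rewrite Nat.add_1_r, Nat.add_1_r, <- !tech_pow_Rmult. unfold Rdiv at 4.
rewrite Rpow_mult_distr, pow_inv, !(pow_mult 2 2).
replace (2 ^ 2) with 4 by ring.
assert (H4 : 4 <= 4 ^ k).
{ rewrite <- (pow_1 4) at 1. apply Rle_pow; [lra | exact Hk]. }
field. split; [|split]; try apply INR_fact_neq_0; lra.
Qed.

(** * Sums over the odd integers *)

Lemma zeta_nat m :
  zeta (INR m) = Series (fun n => / INR (S n) ^ m).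
Proof.
apply Series_ext. intros n.
rewrite Rpower_Ropp, Rpower_pow by (apply lt_0_INR; lia). reflexivity.
Qed.

Lemma is_series_zeta m : (2 <= m)%nat ->
  is_series (fun n => / INR (S n) ^ m) (zeta (INR m)).
Proof.
intros Hm. rewrite zeta_nat. apply Series_correct.
assert (Hpos : forall n, 1 <= INR (S n)).
{ intros n. rewrite S_INR. generalize (pos_INR n). lra. }
destruct (ex_finite_lim_seq_incr (sum_n (fun n => / INR (S n) ^ m)) 2) as [l Hl].
- intros n. rewrite sum_Sn.
  assert (0 < / INR (S (S n)) ^ m).
  { apply Rinv_0_lt_compat, pow_lt. specialize (Hpos (S n)). lra. }
  change (sum_n (fun n => / INR (S n) ^ m) n
          <= sum_n (fun n => / INR (S n) ^ m) n + / INR (S (S n)) ^ m). lra.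
(* Telescoping: 1 / (x + 1) ^ 2 <= 1 / x - 1 / (x + 1). *)
- intros N. apply Rle_trans with (2 - / INR (S N)).
  + induction N as [|N IH].
    * rewrite sum_O. simpl (INR 1). rewrite pow1. lra.
    * rewrite sum_Sn.
      apply Rle_trans with (2 - / INR (S N) + / INR (S (S N)) ^ 2).
      -- apply Rplus_le_compat; [exact IH|].
         apply Rinv_le_contravar; [apply pow_lt; specialize (Hpos (S N)); lra|].
         apply Rle_pow; [apply Hpos | exact Hm].
      -- specialize (Hpos N). rewrite (S_INR (S N)). set (x := INR (S N)) in *.
         apply Rminus_le.
         replace (_ - _) with (- / (x * (x + 1) ^ 2)) by (field; lra).
         assert (0 < / (x * (x + 1) ^ 2)); [|lra].
         apply Rinv_0_lt_compat, Rmult_lt_0_compat; [lra | apply pow_lt; lra].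
  + assert (0 < / INR (S N)); [|lra].
    apply Rinv_0_lt_compat. specialize (Hpos N). lra.
- now exists l.
Qed.

Lemma is_series_zeta_odd_part m : (2 <= m)%nat ->
  is_series (fun n => / (2 * INR n + 1) ^ m) (zeta (INR m) * (1 - 1 / 2 ^ m)).
Proof.
intros Hm. assert (Hz := is_series_zeta m Hm).
assert (H := is_series_minus _ _ _ _ (is_series_pair _ _ Hz)
               (is_series_scal_l (/ 2 ^ m) _ _ Hz)).
match type of H with is_series _ ?l =>
  replace (zeta (INR m) * (1 - 1 / 2 ^ m)) with l end.
- revert H. apply is_series_ext. intros n.
  match goal with |- plus ?x (opp (scal ?c ?y)) = ?z => change (x - c * y = z) end.
  rewrite <- Rinv_mult, <- Rpow_mult_distr.
  replace (2 * INR (S n)) with (INR (S (2 * n + 1))).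
  + replace (INR (S (2 * n))) with (2 * INR n + 1); [ring|].
    rewrite S_INR, mult_INR. reflexivity.
  + rewrite !S_INR, plus_INR, mult_INR. simpl. ring.
- match goal with |- plus ?x (opp (scal ?c ?y)) = ?z => change (x - c * y = z) end.
  unfold Rdiv. ring.
Qed.

(** * The series of zeta values *)

(** Under the sign [((-1) ^ S p) ^ n] the same grouping serves both parities of
    the exponent: the terms are all positive when [S p] is even and alternate
    when it is odd. *)
Lemma is_series_pair_tail p T :
  is_series (fun n => ((-1) ^ S p) ^ n / (2 * INR n + 1) ^ S p) T ->
  is_series (fun j => / (4 * INR j + 3) ^ S p + (-1) ^ S p / (4 * INR j + 5) ^ S p)
    ((-1) ^ S p * (T - 1)).
Proof.
intros HT.
assert (H : is_series (fun n => ((-1) ^ S p) ^ S n / (2 * INR (S n) + 1) ^ S p) (T - 1)).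
{ apply (is_series_incr_1 (fun n => ((-1) ^ S p) ^ n / (2 * INR n + 1) ^ S p)).
  assert (E : T - 1 + ((-1) ^ S p) ^ 0 / (2 * INR 0 + 1) ^ S p = T).
  { change (INR 0) with 0. rewrite Rmult_0_r, Rplus_0_l, pow1, pow_O. field. }
  match goal with |- is_series _ (plus ?x ?y) => change (plus x y) with (x + y) end.
  rewrite E. exact HT. }
apply is_series_pair, (is_series_scal_l ((-1) ^ S p)) in H.
revert H. apply is_series_ext. intros j.
match goal with |- scal ?c ?x = ?z => change (c * x = z) end.
assert (H1 := pow_m1_mul_self (S p)).
set (s := (-1) ^ S p) in *.
assert (Hs : s ^ (2 * j) = 1).
{ rewrite pow_mult. replace (s ^ 2) with (s * s) by ring. rewrite H1. apply pow1. }
replace (2 * j + 1)%nat with (S (2 * j)) by lia.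
rewrite <- (tech_pow_Rmult s (S (2 * j))), <- (tech_pow_Rmult s (2 * j)), Hs.
replace (2 * INR (S (2 * j)) + 1) with (4 * INR j + 3)
  by (rewrite S_INR, mult_INR; simpl; ring).
replace (2 * INR (S (S (2 * j))) + 1) with (4 * INR j + 5)
  by (rewrite !S_INR, mult_INR; simpl; ring).
unfold Rdiv. rewrite !Rmult_1_r.
transitivity (s * s * (/ (4 * INR j + 3) ^ S p + s * / (4 * INR j + 5) ^ S p)); [ring|].
rewrite H1. ring.
Qed.

(** Since [binom (2 n) (S p) / n] is [2 / (S p)] times [binom (2 n - 1) p], the
    series is [2 / (S p)] times the double sum of
    [binom (2 n - 1) p / (4 k) ^ (2 n)]; its terms are nonnegative, so it may be
    summed over [n] first. *)
Lemma is_series_zeta_binom p T :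
  is_series (fun n => ((-1) ^ S p) ^ n / (2 * INR n + 1) ^ S p) T ->
  is_series (fun j => zeta (INR (2 * S j)) / (INR (S j) * 16 ^ S j) * binom (2 * S j) (S p))
    (1 / INR (S p) * ((-1) ^ S p * (T - 1))).
Proof.
intros HT.
set (x := fun j => / (4 * INR (S j))).
assert (Hj : forall j, 1 <= INR (S j)).
{ intros j. rewrite S_INR. generalize (pos_INR j). lra. }
assert (Hx : forall j, 0 < x j < 1).
{ intros j. unfold x. specialize (Hj j). split.
  - apply Rinv_0_lt_compat. lra.
  - rewrite <- Rinv_1. apply Rinv_lt_contravar; lra. }
set (a := fun n j => binom (2 * n + 1) p * x j ^ (2 * n + 2)).
assert (Ha : is_series (fun n => Series (a n)) ((-1) ^ S p * (T - 1) / 2)).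
{ apply (is_series_tonelli a
    (fun j => / 2 * (/ (4 * INR j + 3) ^ S p + (-1) ^ S p / (4 * INR j + 5) ^ S p))).
  - intros n j. apply Rmult_le_pos; [apply binom_nonneg|].
    apply pow_le. specialize (Hx j). lra.
  - intros j. specialize (Hx j). specialize (Hj j).
    assert (H : is_series (fun n => a n j) _)
      by (apply is_series_binom_odd; rewrite Rabs_pos_eq; lra).
    match type of H with is_series _ ?l => match goal with |- is_series _ ?l' =>
      replace l' with l; [exact H|] end end.
    replace (x j / (1 - x j)) with (/ (4 * INR j + 3)).
    + replace (x j / (1 + x j)) with (/ (4 * INR j + 5)).
      * rewrite !pow_inv. unfold Rdiv. ring.
      * unfold x. rewrite S_INR in *. field. lra.
    + unfold x. rewrite S_INR in *. field. lra.
  - unfold Rdiv at 2. rewrite Rmult_comm.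
    exact (is_series_scal_l (/ 2) _ _ (is_series_pair_tail p T HT)). }
apply (is_series_scal_l (2 / INR (S p))) in Ha.
specialize (Hj p) as Hp.
replace (1 / INR (S p) * ((-1) ^ S p * (T - 1)))
  with (2 / INR (S p) * ((-1) ^ S p * (T - 1) / 2)) by (field; lra).
revert Ha. apply is_series_ext. intros n.
match goal with |- scal ?c ?y = ?z => change (c * y = z) end.
assert (Hrow : Series (a n) = binom (2 * n + 1) p * (/ 16 ^ S n * zeta (INR (2 * S n)))).
{ rewrite zeta_nat. rewrite <- !Series_scal_l.
  apply Series_ext. intros j. unfold a, x. f_equal.
  rewrite <- Rinv_mult. replace (2 * n + 2)%nat with (2 * S n)%nat by lia.
  rewrite pow_inv, Rpow_mult_distr, (pow_mult 4 2).
  replace (4 ^ 2) with 16 by ring. reflexivity. }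
rewrite Hrow.
assert (Habs := binom_absorption (2 * n + 1) p).
replace (S (2 * n + 1)) with (2 * S n)%nat in Habs by lia.
rewrite (mult_INR 2 (S n)) in Habs. simpl (INR 2) in Habs.
assert (H16 : 16 ^ S n <> 0) by (apply pow_nonzero; lra).
replace (binom (2 * S n) (S p))
  with ((1 + 1) * INR (S n) * binom (2 * n + 1) p / INR (S p)).
- specialize (Hj n). field. repeat split; try assumption; lra.
- rewrite <- Habs. field. lra.
Qed.

Theorem theorem2p6 : forall m : nat, (1 <= m)%nat ->
  is_series
    (fun j : nat => let n := S j in
       zeta (INR (2 * n)) / (INR n * 16 ^ n) * binom (2 * n) m)
    (if Nat.odd m then
       1 / INR m *
       (1 - (if (m =? 1)%nat then PI / 4
             else zetaE (m - 1) * (1 - 1 / 2 ^ (m - 1))))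
     else
       1 / INR m * (zeta (INR m) * (1 - 1 / 2 ^ m) - 1)).
Proof.
intros [|p] Hm; [lia|]. cbv zeta.
destruct (Nat.Even_or_Odd (S p)) as [[k Hk]|[k Hk]].
- replace (Nat.odd (S p)) with false
    by (symmetry; rewrite Hk, Nat.odd_even; reflexivity).
  assert (Hs : (-1) ^ S p = 1) by (rewrite Hk; apply pow_1_even).
  assert (H := is_series_zeta_binom p (zeta (INR (S p)) * (1 - 1 / 2 ^ S p))).
  rewrite Hs in H. rewrite <- (Rmult_1_l (_ - 1)). apply H.
  apply (is_series_ext (fun n => / (2 * INR n + 1) ^ S p)).
  + intros n. rewrite pow1. unfold Rdiv. now rewrite Rmult_1_l.
  + apply is_series_zeta_odd_part. lia.
- replace (Nat.odd (S p)) with true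
    by (symmetry; rewrite Hk, Nat.odd_odd; reflexivity).
  assert (Hs : (-1) ^ S p = -1) by (rewrite Hk, Nat.add_1_r; apply pow_1_odd).
  assert (Hb : (if (S p =? 1)%nat then PI / 4
                else zetaE (S p - 1) * (1 - 1 / 2 ^ (S p - 1))) = beta_odd k).
  { destruct k as [|k].
    - replace p with 0%nat by lia. unfold beta_odd. simpl. rewrite euler_0. field.
    - destruct (Nat.eqb_spec (S p) 1); [lia|].
      replace (S p - 1)%nat with (2 * S k)%nat by lia.
      apply beta_odd_zetaE. lia. }
  rewrite Hb.
  assert (H := is_series_zeta_binom p (beta_odd k)). rewrite Hs in H.
  replace (1 - beta_odd k) with (-1 * (beta_odd k - 1)) by ring. apply H.
  rewrite Hk. apply is_series_beta_odd.
Qed.
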